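(* Every vanishing expression of bracket symbols can be transformed, using only arithmetical operations of (commuting) bracket symbols, into a combination of the basic syzygies. That is: let $B_I$ be the commutative polynomial algebra over $\mathbb C$ freely generated by commuting symbols $[ij]$, $i,j\in I$, and let $e\in B_I$ be such that substituting $[ij]\mapsto(ij)$ in $e$ gives $0$ in $H_I$. Then there are elements $I_{ij},I_{ijkl}\in B_I$ (almost all zero) such that $$e=\sum_{ij}\bigl([ij]+[ji]\bigr)I_{ij}+\sum_{ijkl}\bigl([ij][kl]+[ik][lj]+[il][jk]\bigr)I_{ijkl}.$$
   Context: Fix $h\in\mathbb C$, $h\neq0$. For a totally ordered index set $I$, $H_I$ is the unital complex algebra with generators $x_i,y_i$ ($i\in I$) and relations $x_iy_i=y_ix_i+hy_i^2$ and, for $i<j$, $x_jy_i=y_ix_j+hy_iy_j$, $y_jx_i=x_iy_j-hy_iy_j$, $y_jy_i=y_iy_j$, $x_jx_i=x_ix_j-hx_iy_j+hy_ix_j+h^2y_iy_j$. The bracket symbols are $(ij)=x_iy_j-y_ix_j-hy_iy_j\in H_I$; they are central in $H_I$ and in particular commute with each other. *)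

(* Defs.v *)
From HB Require Import structures.
From mathcomp Require Import all_boot all_order all_algebra.
From mathcomp Require Import ring_quotient finmap monalg.
From mathcomp Require Import boolp.

Set Implicit Arguments.
Unset Strict Implicit.
Unset Printing Implicit Defensive.

Import Order.TTheory GRing.Theory.

Local Open Scope ring_scope.
Local Open Scope quotient_scope.

(* The two-sided ideal of A generated by the differences u - v, for rel u v. *)
Inductive gen_ideal (A : nzRingType) (rel : A -> A -> Prop) : A -> Prop :=
| gen_ideal0 : gen_ideal rel 0
| gen_idealD a b :
    gen_ideal rel a -> gen_ideal rel b -> gen_ideal rel (a + b)
| gen_idealM a b u v : rel u v -> gen_ideal rel (a * (u - v) * b).

Lemma gen_idealN (A : nzRingType) (rel : A -> A -> Prop) a :
  gen_ideal rel a -> gen_ideal rel (- a).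
Proof.
elim=> [|b c _ Hb _ Hc|b c u v uv].
- by rewrite oppr0; exact: gen_ideal0.
- by rewrite opprD; exact: gen_idealD.
- by rewrite -!mulNr; exact: gen_idealM.
Qed.

Lemma gen_idealMl (A : nzRingType) (rel : A -> A -> Prop) c a :
  gen_ideal rel a -> gen_ideal rel (c * a).
Proof.
elim=> [|b e _ Hb _ He|b e u v uv].
- by rewrite mulr0; exact: gen_ideal0.
- by rewrite mulrDr; exact: gen_idealD.
- by rewrite !mulrA; exact: gen_idealM.
Qed.

Lemma gen_idealMr (A : nzRingType) (rel : A -> A -> Prop) c a :
  gen_ideal rel a -> gen_ideal rel (a * c).
Proof.
elim=> [|b e _ Hb _ He|b e u v uv].
- by rewrite mul0r; exact: gen_ideal0.
- by rewrite mulrDl; exact: gen_idealD.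
- by rewrite -mulrA; exact: gen_idealM.
Qed.

(* The quotient of A by the ideal generated by rel. The properness hypothesis  *)
(* is needed because the library's algebras are nonzero.                       *)
Section PresentedAlgebra.
Context (K : comNzRingType) (A : algType K) (rel : A -> A -> Prop).

Definition pres_ideal : {pred A} :=
  fun a => `[< gen_ideal rel a >].

Lemma pres_idealP a :
  reflect (gen_ideal rel a) (a \in pres_ideal).
Proof. exact: asboolP. Qed.

Lemma pres_ideal_zmod_closed : zmod_closed pres_ideal.
Proof.
split=> [|a b /pres_idealP Ha /pres_idealP Hb]; apply/pres_idealP.
  exact: gen_ideal0.
by apply: gen_idealD => //; exact: gen_idealN.
Qed.

HB.instance Definition _ :=
  GRing.isZmodClosed.Build A pres_ideal pres_ideal_zmod_closed.

Lemma pres_idealMl c a : a \in pres_ideal -> c * a \in pres_ideal.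
Proof. by move=> /pres_idealP Ha; apply/pres_idealP/gen_idealMl. Qed.

Lemma pres_idealMr c a : a \in pres_ideal -> a * c \in pres_ideal.
Proof. by move=> /pres_idealP Ha; apply/pres_idealP/gen_idealMr. Qed.

Definition pres_alg of ~ gen_ideal rel 1 : Type := Quotient.quot pres_ideal.

Context (proper : ~ gen_ideal rel 1).
Local Notation Q := (pres_alg proper).

HB.instance Definition _ := GRing.Zmodule.on Q.
HB.instance Definition _ := EqQuotient.on Q.

Local Notation pi := (\pi_(pres_alg proper) : A -> Q).

Lemma pres_eqP (a b : A) :
  reflect (pi a = pi b) (a - b \in pres_ideal).
Proof. by rewrite Quotient.idealrBE; exact: eqP. Qed.

Lemma piD (a b : A) : pi (a + b) = pi a + pi b.
Proof. exact: (raddfD (\pi_(Quotient.quot pres_ideal))). Qed.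

Definition pres_mul (a b : Q) : Q := pi (repr a * repr b).
Definition pres_scale (k : K) (a : Q) : Q := pi (k *: repr a).

Lemma piM (a b : A) : pi (a * b) = pres_mul (pi a) (pi b).
Proof.
have E c : c - repr (pi c) \in pres_ideal by apply/pres_eqP; rewrite reprK.
apply/pres_eqP; rewrite -(subrKA (a * repr (pi b))) -mulrBr -mulrBl.
by apply: rpredD; [exact: pres_idealMl|exact: pres_idealMr].
Qed.

Lemma piZ k (a : A) : pi (k *: a) = pres_scale k (pi a).
Proof.
apply/pres_eqP; rewrite -scalerBr -[_ - _]mul1r scalerAl.
by apply: pres_idealMl; apply/pres_eqP; rewrite reprK.
Qed.

Lemma pres_ind (P : Q -> Prop) : (forall a, P (pi a)) -> forall z, P z.
Proof. by move=> HP z; rewrite -[z]reprK; exact: HP. Qed.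

Lemma pres_mulA : associative pres_mul.
Proof.
elim/pres_ind=> a; elim/pres_ind=> b; elim/pres_ind=> c.
by rewrite -(piM b c) -(piM a b) -(piM a) -(piM _ c) mulrA.
Qed.

Lemma pres_mul1 : left_id (pi 1) pres_mul.
Proof. by elim/pres_ind=> a; rewrite -(piM 1 a) mul1r. Qed.

Lemma pres_mulr1 : right_id (pi 1) pres_mul.
Proof. by elim/pres_ind=> a; rewrite -(piM a 1) mulr1. Qed.

Lemma pres_mulDl : left_distributive pres_mul +%R.
Proof.
elim/pres_ind=> a; elim/pres_ind=> b; elim/pres_ind=> c.
by rewrite -(piM a c) -(piM b c) -!piD -(piM _ c) mulrDl.
Qed.

Lemma pres_mulDr : right_distributive pres_mul +%R.
Proof.
elim/pres_ind=> a; elim/pres_ind=> b; elim/pres_ind=> c.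
by rewrite -(piM a c) -(piM a b) -!piD -(piM a) mulrDr.
Qed.

Lemma pres_oner_neq0 : pi 1 != 0.
Proof.
have -> : 0 = pi 0 by rewrite -[RHS](addrK (pi 0)) -piD addr0 subrr.
by apply/eqP => /pres_eqP; rewrite subr0 => /pres_idealP.
Qed.

HB.instance Definition _ := GRing.Zmodule_isNzRing.Build Q
  pres_mulA pres_mul1 pres_mulr1 pres_mulDl pres_mulDr pres_oner_neq0.

Lemma pres_scaleA k l a : pres_scale k (pres_scale l a) = pres_scale (k * l) a.
Proof. by elim/pres_ind: a => a; rewrite -(piZ l) -(piZ k) -piZ scalerA. Qed.

Lemma pres_scale1 : left_id 1 pres_scale.
Proof. by elim/pres_ind=> a; rewrite -piZ scale1r. Qed.

Lemma pres_scaleDr : right_distributive pres_scale +%R.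
Proof.
move=> k; elim/pres_ind=> a; elim/pres_ind=> b.
by rewrite -(piZ k a) -(piZ k b) -!piD -piZ scalerDr.
Qed.

Lemma pres_scaleDl a : {morph pres_scale^~ a : k l / k + l}.
Proof. by move=> k l; elim/pres_ind: a => a; rewrite -!piZ -piD scalerDl. Qed.

HB.instance Definition _ := GRing.Zmodule_isLmodule.Build K Q
  pres_scaleA pres_scale1 pres_scaleDr pres_scaleDl.

Lemma pres_scalerAl k (a b : Q) : k *: (a * b) = (k *: a) * b.
Proof.
suff : pres_scale k (pres_mul a b) = pres_mul (pres_scale k a) b by [].
elim/pres_ind: a => a; elim/pres_ind: b => b.
by rewrite -(piM a b) -(piZ k a) -(piZ k) -(piM _ b) scalerAl.
Qed.

HB.instance Definition _ := GRing.Lmodule_isLalgebra.Build K Q pres_scalerAl.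

Lemma pres_scalerAr k (a b : Q) : k *: (a * b) = a * (k *: b).
Proof.
suff : pres_scale k (pres_mul a b) = pres_mul a (pres_scale k b) by [].
elim/pres_ind: a => a; elim/pres_ind: b => b.
by rewrite -(piM a b) -(piZ k b) -(piZ k) -(piM a) scalerAr.
Qed.

HB.instance Definition _ := GRing.Lalgebra_isAlgebra.Build K Q pres_scalerAr.

Definition pres_pi (a : A) : Q := pi a.

Lemma pres_pi_is_zmod_morphism : zmod_morphism pres_pi.
Proof. by move=> a b; apply: (raddfB (\pi_(Quotient.quot pres_ideal))). Qed.

Lemma pres_pi_is_monoid_morphism : monoid_morphism pres_pi.
Proof. by split=> // a b; exact: piM. Qed.

Lemma pres_pi_is_scalable : scalable pres_pi.
Proof. by move=> k a; exact: piZ. Qed.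

HB.instance Definition _ := GRing.isZmodMorphism.Build
  A Q pres_pi pres_pi_is_zmod_morphism.
HB.instance Definition _ := GRing.isMonoidMorphism.Build
  A Q pres_pi pres_pi_is_monoid_morphism.
HB.instance Definition _ := GRing.isScalable.Build
  K A Q *:%R pres_pi pres_pi_is_scalable.

Lemma pres_pi_eqP (a b : A) :
  pres_pi a = pres_pi b <-> gen_ideal rel (a - b).
Proof.
by split=> [/pres_eqP/pres_idealP|H] //; apply/pres_eqP/pres_idealP.
Qed.

Lemma pres_pi_surj (z : Q) : exists a, z = pres_pi a.
Proof. by exists (repr z); rewrite /pres_pi reprK. Qed.

Lemma pres_pi_rel u v : rel u v -> pres_pi u = pres_pi v.
Proof.
move=> uv; apply/pres_pi_eqP; rewrite -[_ - _]mulr1 -[_ - _]mul1r.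
exact: gen_idealM.
Qed.

End PresentedAlgebra.

Lemma malg_scalerAr (M : monomType) (K : comNzRingType) (k : K)
  (u v : {malg K[M]}) : k *: (u * v) = u * (k *: v).
Proof.
apply/malgP => w; rewrite mcoeffZ.
rewrite (@mcoeffMlw M K (msupp u) (msupp v) u v) ?fsubset_refl //.
rewrite (@mcoeffMlw M K (msupp u) (msupp v)) ?fsubset_refl ?msuppZ_le //.
rewrite mulr_sumr; apply: eq_bigr => k1 _.
rewrite mulr_sumr; apply: eq_bigr => k2 _.
by rewrite mcoeffZ mulrnAr mulrCA.
Qed.

(* The free associative algebra on the x_i, y_i (i : I): the letters inl i and *)
(* inr i stand for x_i and y_i, and {fmonom _} is the free monoid of words.    *)
Definition freeXY (K : comNzRingType) (I : choiceType) : Type :=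
  {malg K[{fmonom (I + I)%type}]}.

HB.instance Definition _ (K : comNzRingType) (I : choiceType) :=
  GRing.Lalgebra.copy (freeXY K I) {malg K[{fmonom (I + I)%type}]}.

Section FreeAlgebra.
Context (K : comNzRingType) (I : choiceType).

HB.instance Definition _ :=
  GRing.Lalgebra_isAlgebra.Build K (freeXY K I)
    (@malg_scalerAr {fmonom (I + I)%type} K).

Definition freeX (i : I) : freeXY K I := << fmu (inl i) >>.
Definition freeY (i : I) : freeXY K I := << fmu (inr i) >>.

End FreeAlgebra.

(* The defining relations, in an algebra A with elements x_i, y_i (i : I).     *)
Inductive jordan_rel (K : comNzRingType) (d : Order.disp_t) (I : orderType d)
    (A : algType K) (h : K) (x y : I -> A) : A -> A -> Prop :=
| jordan_rel_xy i :
    jordan_rel h x y (x i * y i) (y i * x i + h *: y i ^+ 2)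
| jordan_rel_xy_lt i j of (i < j)%O :
    jordan_rel h x y (x j * y i) (y i * x j + h *: (y i * y j))
| jordan_rel_yx_lt i j of (i < j)%O :
    jordan_rel h x y (y j * x i) (x i * y j - h *: (y i * y j))
| jordan_rel_yy_lt i j of (i < j)%O :
    jordan_rel h x y (y j * y i) (y i * y j)
| jordan_rel_xx_lt i j of (i < j)%O :
    jordan_rel h x y (x j * x i)
      (x i * x j - h *: (x i * y j) + h *: (y i * x j)
       + h ^+ 2 *: (y i * y j)).

Lemma jordan_rel_lift (K : comNzRingType) (d : Order.disp_t) (I : orderType d)
    (A B : algType K) (f : {lrmorphism A -> B}) (h : K) (x y : I -> A) u v :
  jordan_rel h (f \o x) (f \o y) u v ->
  exists u' v', [/\ jordan_rel h x y u' v', u = f u' & v = f v'].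
Proof.
have fZ k a : f (k *: a) = k *: f a by rewrite linearZ.
have fD a b : f (a + b) = f a + f b by rewrite rmorphD.
have fB a b : f (a - b) = f a - f b by rewrite rmorphB.
have fM a b : f (a * b) = f a * f b by rewrite rmorphM.
case=> [i|i j ij|i j ij|i j ij|i j ij]; do 2![eexists]; split.
- exact: jordan_rel_xy.
- by rewrite fM.
- by rewrite fD fZ !fM.
- exact: jordan_rel_xy_lt ij.
- by rewrite fM.
- by rewrite fD fZ !fM.
- exact: jordan_rel_yx_lt ij.
- by rewrite fM.
- by rewrite fB fZ !fM.
- exact: jordan_rel_yy_lt ij.
- by rewrite fM.
- by rewrite fM.
- exact: jordan_rel_xx_lt ij.
- by rewrite fM.
- by rewrite 2!fD fB !fZ !fM.
Qed.

Section JordanRelTheory.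
Context (K : comNzRingType) (d : Order.disp_t) (I : orderType d).
Context (A : algType K) (h : K) (jx jy : I -> A).

Lemma jordan_rel_proper (c : A -> K) :
  zmod_morphism c -> monoid_morphism c -> (forall k a, c (k *: a) = k * c a) ->
  (forall i, c (jx i) = 0) -> (forall i, c (jy i) = 0) ->
  forall a, gen_ideal (jordan_rel h jx jy) a -> c a = 0.
Proof.
move=> cB [c1 cM] cZ cX cY.
have c0 : c 0 = 0 by rewrite -(subrr 0) cB subrr.
have cN v : c (- v) = - c v by rewrite -[- v]sub0r cB c0 sub0r.
have cD u v : c (u + v) = c u + c v by rewrite -{1}[v]opprK cB cN opprK.
move=> a; elim=> [//|{}a b _ Ha _ Hb|{}a b u v uv].
  by rewrite cD Ha Hb addr0.
suff E : c (u - v) = 0 by rewrite !cM E mulr0 mul0r.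
by case: uv => *; rewrite ?expr2 !(cD, cN, cZ) !cM ?cX ?cY;
  rewrite !(mulr0, mul0r, oppr0, addr0).
Qed.

Context (relE : forall u v, jordan_rel h jx jy u v -> u = v).

Let bracket i j := jx i * jy j - jy i * jx j - h *: (jy i * jy j).

Lemma jordan_rel_yyC i j : jy i * jy j = jy j * jy i.
Proof.
by case: (ltgtP i j) => [ij|ij|-> //];
  have := relE (jordan_rel_yy_lt h jx jy ij).
Qed.

Lemma jordan_rel_xyC i j : jx i * jy j = jy j * jx i + h *: (jy i * jy j).
Proof.
case: (ltgtP i j) => [ij|ij|<-].
- by rewrite (relE (jordan_rel_yx_lt h jx jy ij)) subrK.
- by rewrite (relE (jordan_rel_xy_lt h jx jy ij)) [jy i * _]jordan_rel_yyC.
- exact: relE (jordan_rel_xy h jx jy i).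
Qed.

Lemma jordan_rel_xxC i j : jx i * jx j = jx j * jx i + h *: (jy j * jx i - jy i * jx j).
Proof.
have H k l : (k < l)%O ->
    jx l * jx k = jx k * jx l + h *: (jy k * jx l - jy l * jx k).
  move=> kl; rewrite (relE (jordan_rel_xx_lt h jx jy kl)).
  rewrite jordan_rel_xyC scalerDr scalerA -expr2 scalerBr -!addrA; congr (_ + _).
  rewrite opprD -!addrA [X in _ = X]addrC; congr (_ + _).
  by rewrite addrCA addNr addr0.
case: (ltgtP i j) => [ij|ij|->]; last by rewrite subrr scaler0 addr0.
  by rewrite (H _ _ ij) -addrA -scalerDr addrA subrK subrr scaler0 addr0.
exact: H.
Qed.

Lemma jordan_rel_bracketE i j : bracket i j = jy j * jx i - jy i * jx j.
Proof. by rewrite /bracket jordan_rel_xyC addrAC addrK. Qed.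

Lemma jordan_rel_bracket_commY i j k : GRing.comm (jy k) (bracket i j).
Proof.
have E a b : jy b * jx a * jy k = jy k * (jy b * jx a) + h *: (jy a * jy b * jy k).
  rewrite -mulrA jordan_rel_xyC mulrDr -scalerAr !mulrA [jy b * jy k]jordan_rel_yyC.
  by rewrite [jy b * jy a]jordan_rel_yyC.
rewrite /GRing.comm jordan_rel_bracketE mulrBr mulrBl !E [jy j * jy i]jordan_rel_yyC.
by rewrite opprD addrACA subrr addr0.
Qed.

Lemma jordan_rel_bracket_commX i j k : GRing.comm (jx k) (bracket i j).
Proof.
have E a b : jx k * (jy b * jx a) = jy b * jx a * jx k
    + h *: (jy b * jy a * jx k).
  rewrite mulrA jordan_rel_xyC mulrDl -scalerAl -!mulrA jordan_rel_xxC mulrDr.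
  rewrite -scalerAr mulrBr.
  rewrite -addrA -scalerDr; congr (_ + h *: _).
  by rewrite !mulrA [jy b * jy k]jordan_rel_yyC subrK.
rewrite /GRing.comm jordan_rel_bracketE mulrBr mulrBl !E [jy j * jy i]jordan_rel_yyC.
by rewrite opprD addrACA subrr addr0.
Qed.

Lemma jordan_rel_bracket_comm i j k l : GRing.comm (bracket i j) (bracket k l).
Proof.
rewrite [bracket k l]jordan_rel_bracketE; apply: commrB; apply: commrM; apply/commr_sym;
  by [exact: jordan_rel_bracket_commX|exact: jordan_rel_bracket_commY].
Qed.

End JordanRelTheory.

(* Evaluation of a commutative polynomial at elements b_p of a possibly        *)
(* noncommutative algebra. The order of the factors of a monomial is           *)
(* irrelevant when the b_p commute, which is the only intended use.            *)
Section CommEval.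
Context (K : comNzRingType) (T : choiceType) (A : algType K) (b : T -> A).

Definition monom_eval (m : {cmonom T}) : A :=
  \prod_(p <- finsupp m) b p ^+ m p.

Definition poly_eval (e : {malg K[{cmonom T}]}) : A :=
  mmap (in_alg A) monom_eval e.

Lemma poly_eval_var p : poly_eval << ucm p >> = b p.
Proof.
rewrite /poly_eval mmapU /= scale1r mul1r /monom_eval mdomU.
by rewrite big_seq_fset1 cmUU expr1.
Qed.

Context (bC : forall p q, GRing.comm (b p) (b q)).

Lemma commXX (m n : T -> nat) p q : GRing.comm (b p ^+ m p) (b q ^+ n q).
Proof. exact/commrX/commr_sym/commrX. Qed.

Lemma monom_eval_perm (m : T -> nat) (s t : seq T) :
  perm_eq s t -> \prod_(p <- s) b p ^+ m p = \prod_(p <- t) b p ^+ m p.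
Proof.
elim: s t => [|x s IHs] t; first by rewrite perm_sym => /perm_nilP ->.
move=> pst; have tx : x \in t by rewrite -(perm_mem pst) mem_head.
have {pst} prem : perm_eq s (rem x t).
  by rewrite -(perm_cons x) (perm_trans pst) // perm_to_rem.
rewrite big_cons (IHs _ prem) {IHs prem}.
elim: t tx => [//|y t IHt]; rewrite inE /=.
case: (eqVneq y x) => [->|nyx] /=; first by rewrite big_cons.
by move=> tx; rewrite !big_cons mulrA (commXX m m x y) -mulrA IHt.
Qed.

Lemma monom_evalEw (m : {cmonom T}) (E : {fset T}) :
  (finsupp m `<=` E)%fset -> monom_eval m = \prod_(p <- E) b p ^+ m p.
Proof.
move=> mE; rewrite /monom_eval.
have -> : \prod_(p <- E) b p ^+ m p =
    \prod_(p <- [seq p <- E | p \in finsupp m]) b p ^+ m p.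
  rewrite big_filter [RHS]big_mkcond; apply: eq_bigr => p _.
  by case: finsuppP => // _; rewrite expr0.
apply: monom_eval_perm; apply: uniq_perm => //; first exact: filter_uniq.
move=> p; rewrite mem_filter; case: (boolP (p \in finsupp m)) => //= pm.
by rewrite (fsubsetP mE).
Qed.

Lemma monom_eval_mmorphism : mmorphism monom_eval.
Proof.
split; last by rewrite /monom_eval mdom1 big_seq_fset0.
move=> m n; set E := (finsupp m `|` finsupp n)%fset.
rewrite (@monom_evalEw m E) ?fsubsetUl // (@monom_evalEw n E) ?fsubsetUr //.
rewrite (@monom_evalEw _ E) ?mdomD // {}/E.
elim: (enum_fset _) => [|p s IHs]; first by rewrite !big_nil mulr1.
rewrite !big_cons IHs cmM exprD -!mulrA; congr (_ * _); rewrite !mulrA.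
by congr (_ * _); apply: commr_prod => q _; exact: commXX.
Qed.

HB.instance Definition _ :=
  isMultiplicative.Build {cmonom T} A monom_eval monom_eval_mmorphism.

Lemma poly_eval_is_zmod_morphism : zmod_morphism poly_eval.
Proof. exact: mmap_is_additive. Qed.

Lemma poly_eval_is_monoid_morphism : monoid_morphism poly_eval.
Proof.
have H : multiplicative poly_eval.
  by apply: commr_mmap_is_multiplicative => g m n; exact: comm_alg.
by split; [exact: H.2|exact: H.1].
Qed.

Lemma poly_eval_is_scalable : scalable poly_eval.
Proof. by move=> c e; rewrite /poly_eval mmapZ mulr_algl. Qed.

End CommEval.

Section JordanAlgebra.
Context (K : comNzRingType) (d : Order.disp_t) (I : orderType d) (h : K).

Lemma jordan_proper : ~ gen_ideal (jordan_rel h (@freeX K I) (@freeY K I)) 1.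
Proof.
move=> H; move: (oner_neq0 K); apply/negP; rewrite negbK.
pose c : freeXY K I -> K := @mcoeff {fmonom (I + I)%type} K mone.
have [cM c1] : multiplicative c by exact: mcoeff1g_is_multiplicative.
have cB : zmod_morphism c by exact: mcoeff_is_additive.
have cZ k u : c (k *: u) = k * c u by exact: mcoeffZ.
have cX i : c (freeX K i) = 0 by rewrite /c /freeX mcoeffU fm1_eq1.
have cY i : c (freeY K i) = 0 by rewrite /c /freeY mcoeffU fm1_eq1.
by rewrite -c1; apply/eqP; apply: jordan_rel_proper H.
Qed.

Definition jordan : Type := pres_alg jordan_proper.

HB.instance Definition _ := GRing.Algebra.on jordan.

Definition jx (i : I) : jordan := pres_pi jordan_proper (freeX K i).
Definition jy (i : I) : jordan := pres_pi jordan_proper (freeY K i).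

Definition bracket (i j : I) : jordan :=
  jx i * jy j - jy i * jx j - h *: (jy i * jy j).

Lemma jordan_relE u v : jordan_rel h jx jy u v -> u = v.
Proof.
by case/jordan_rel_lift=> u' [v' [uv -> ->]]; exact: pres_pi_rel.
Qed.

Lemma bracketE i j : bracket i j = jy j * jx i - jy i * jx j.
Proof. exact: jordan_rel_bracketE jordan_relE _ _. Qed.

Lemma bracket_commX i j k : GRing.comm (jx k) (bracket i j).
Proof. exact: jordan_rel_bracket_commX jordan_relE _ _ _. Qed.

Lemma bracket_commY i j k : GRing.comm (jy k) (bracket i j).
Proof. exact: jordan_rel_bracket_commY jordan_relE _ _ _. Qed.

Lemma bracket_comm i j k l : GRing.comm (bracket i j) (bracket k l).
Proof. exact: jordan_rel_bracket_comm jordan_relE _ _ _ _. Qed.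

(* The symbol [ij] is the variable indexed by (i, j), and {cmonom _} is the    *)
(* free commutative monoid.                                                    *)
Definition bracket_poly : Type := {malg K[{cmonom (I * I)%type}]}.

HB.instance Definition _ := GRing.ComAlgebra.copy bracket_poly
  {malg K[{cmonom (I * I)%type}]}.

Definition bsym (i j : I) : bracket_poly := << ucm (i, j) >>.

Definition bracket_subst (e : bracket_poly) : jordan :=
  poly_eval (fun p => bracket p.1 p.2) e.

Lemma bracket_subst_sym i j : bracket_subst (bsym i j) = bracket i j.
Proof. exact: poly_eval_var. Qed.

Lemma bracketC (p q : I * I) :
  GRing.comm (bracket p.1 p.2) (bracket q.1 q.2).
Proof. exact: bracket_comm. Qed.

HB.instance Definition _ := GRing.isZmodMorphism.Build
  bracket_poly jordan bracket_subst (poly_eval_is_zmod_morphism _).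
HB.instance Definition _ := GRing.isMonoidMorphism.Build
  bracket_poly jordan bracket_subst (poly_eval_is_monoid_morphism bracketC).
HB.instance Definition _ := GRing.isScalable.Build
  K bracket_poly jordan *:%R bracket_subst (poly_eval_is_scalable bracketC).

End JordanAlgebra.

(* Main.v *)
Require Import Defs.
From HB Require Import structures.
From mathcomp Require Import all_boot all_order all_algebra.
From mathcomp Require Import finmap monalg ring zify.
From mathcomp Require Import reals complex.

(* For a commutative algebra A with elements X_i, Y_i, the algebra H_I acts on *)
(* functions f : Z -> A by                                                     *)
(*   (x_i f)(n) = X_i f(n+1) + h (n-1) Y_i f(n-1),   (y_i f)(n) = Y_i f(n-1);  *)
(* this is x_i = X_i + h Y_i E, y_i = Y_i, where the degree operator E, namely *)
(* (E f)(n) = n f(n), satisfies [E, Y_i] = Y_i and [E, X_i] = - X_i. In this   *)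
(* action the bracket (ij) multiplies by the classical minor X_i Y_j - Y_i X_j,*)
(* so every relation between the brackets is a relation between 2x2 minors.    *)
(* For minors one straightens: modulo the syzygies each monomial in the [ij]   *)
(* is a combination of standard ones (i < j in each pair, no pair nested in    *)
(* another), and standard monomials in the minors are linearly independent     *)
(* because they are determined by their leading terms prod X_i Y_j.            *)

Set Implicit Arguments.
Unset Strict Implicit.
Unset Printing Implicit Defensive.

Import Order.TTheory GRing.Theory Num.Theory.
Local Open Scope ring_scope.

(** * The action of H_I on functions *)

(** The proof passes from brackets to minors and then solves the classical problem. In the action on
    functions an expression in the brackets multiplies by the same expression in the minors, so
    whatever vanishes in H_I vanishes on minors ([bracket_subst_eq0_minor]). What remains is the
    second fundamental theorem for 2x2 minors ([minor_eval_eq0]). Modulo syzygies, [e] is a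
    combination of standard monomials ([bracket_poly_straightens]). Syzygies vanish on minors
    ([in_syzygies_eval]), hence so does this combination. By independence ([standard_minors_free])
    it is already zero in the bracket symbols, so [e] lies in the ideal of syzygies. *)

Definition minor (K : comNzRingType) (I : Type) (A : comAlgType K) (X Y : I -> A)
  (p : I * I) : A := X p.1 * Y p.2 - Y p.1 * X p.2.

Section JordanAction.
Context (K : comNzRingType) (d : Order.disp_t) (I : orderType d).
Context (A : comAlgType K) (h : K) (X Y : I -> A).

Definition letter_act (z : I + I) (f : int -> A) (n : int) : A :=
  match z with
  | inl i => X i * f (n + 1) + h%:A * (n - 1)%:~R * Y i * f (n - 1)
  | inr i => Y i * f (n - 1)
  end.

Definition word_act (s : seq (I + I)) (f : int -> A) : int -> A :=
  foldr letter_act f s.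

Definition free_act (a : freeXY K I) (f : int -> A) (n : int) : A :=
  mmap (in_alg A) (fun m : {fmonom (I + I)%type} => word_act m f n) a.

(** Letters act linearly over the commutative algebra [A], as the [c t] do not depend on the point
    of evaluation. *)
Lemma word_act_sum (T : Type) (r : seq T) (c : T -> A) (g : T -> int -> A) s n :
  word_act s (fun k => \sum_(t <- r) c t * g t k) n =
  \sum_(t <- r) c t * word_act s (g t) n.
Proof.
elim: s n => [//|z s IHs] n /=.
rewrite /letter_act; case: z => i.
  rewrite !IHs !mulr_sumr -big_split; apply: eq_bigr => t _ /=.
  by rewrite mulrDr; congr (_ + _); rewrite mulrCA.
by rewrite !IHs mulr_sumr; apply: eq_bigr => t _; rewrite mulrCA.
Qed.

Lemma eq_word_act s f g : f =1 g -> word_act s f =1 word_act s g.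
Proof.
move=> fg; elim: s => [//|z s IHs] n /=.
by case: z => i /=; rewrite !IHs.
Qed.

Lemma free_actD a b f n : free_act (a + b) f n = free_act a f n + free_act b f n.
Proof. exact: mmapD. Qed.

Lemma free_actB a b f n : free_act (a - b) f n = free_act a f n - free_act b f n.
Proof. exact: mmapB. Qed.

Lemma free_act_sum (T : Type) (r : seq T) (a : T -> freeXY K I) f n :
  free_act (\sum_(t <- r) a t) f n = \sum_(t <- r) free_act (a t) f n.
Proof.
exact: (raddf_sum (mmap (in_alg A) (fun m : {fmonom (I + I)%type} => word_act m f n))).
Qed.

Lemma free_actU c m f n :
  free_act << c *g m >> f n = c%:A * word_act (m : {fmonom (I + I)%type}) f n.
Proof. exact: mmapU. Qed.

Lemma free_act1 f n : free_act 1 f n = f n.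
Proof. by rewrite (free_actU 1 mone) scale1r mul1r fm1. Qed.

(** Concatenated words act by composition; linearity of each word extends this to products of
    combinations. *)
Lemma free_actM a b f n : free_act (a * b) f n = free_act a (free_act b f) n.
Proof.
rewrite (malgME a b) free_act_sum /free_act [RHS]mmapE; apply: eq_bigr => k1 _.
rewrite (@eq_word_act _ _ _ (fun k => mmapE _ _ b)) word_act_sum.
rewrite mulr_sumr -/(free_act _ _ _) free_act_sum; apply: eq_bigr => k2 _.
by rewrite free_actU fmM /word_act foldr_cat -in_algE rmorphM mulrA.
Qed.

Lemma free_actZ c a f n : free_act (c *: a) f n = c%:A * free_act a f n.
Proof.
have -> : c *: a = (c%:MP : freeXY K I) * a by rewrite [RHS]mul_malgC.
by rewrite free_actM (free_actU c mone) fm1.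
Qed.

Lemma free_actX i f n : free_act (freeX K i) f n =
  X i * f (n + 1) + h%:A * (n - 1)%:~R * Y i * f (n - 1).
Proof. by rewrite free_actU fmU /= scale1r mul1r. Qed.

Lemma free_actY i f n : free_act (freeY K i) f n = Y i * f (n - 1).
Proof. by rewrite free_actU fmU /= scale1r mul1r. Qed.

Lemma eq_free_act a f g : f =1 g -> free_act a f =1 free_act a g.
Proof.
move=> fg n; rewrite /free_act !mmapE; apply: eq_bigr => m _.
by rewrite (eq_word_act _ fg).
Qed.

Lemma free_act0 a n : free_act a (fun=> 0) n = 0.
Proof.
rewrite /free_act mmapE big1 // => m _.
have -> : word_act m (fun=> 0) n = 0; last by rewrite mulr0.
elim: (m : seq _) n => [//|[] i s IHs] n /=; rewrite !IHs !mulr0 ?addr0 //.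
Qed.

(** * Relations and brackets, checked from the action of the generators *)

Section GeneratorActions.
Context (B : algType K) (x y : I -> B) (act : B -> (int -> A) -> int -> A).
Context (actD : forall a b f n, act (a + b) f n = act a f n + act b f n).
Context (actB : forall a b f n, act (a - b) f n = act a f n - act b f n).
Context (actZ : forall c a f n, act (c *: a) f n = c%:A * act a f n).
Context (actM : forall a b f n, act (a * b) f n = act a (act b f) n).
Context (actX : forall i, act (x i) =2 letter_act (inl i)).
Context (actY : forall i, act (y i) =2 letter_act (inr i)).

Let subr1K (n : int) : n - 1 + 1 = n. Proof. exact: subrK. Qed.
Let addr1K (n : int) : n + 1 - 1 = n. Proof. exact: addrK. Qed.

Lemma jordan_rel_act u v : jordan_rel h x y u v -> act u =2 act v.
Proof.
case=> [i|i j _|i j _|i j _|i j _] f n; rewrite ?expr2;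
  rewrite !(actB, actD, actZ, actM, actX, actY) /= ?actX ?actY /=;
  rewrite ?addr1K ?subr1K -?in_algE ?rmorphM /= ?rmorphB ?rmorphD /=; ring.
Qed.

(** The coefficients h(n-1) from x_i y_j and h(n-2) from y_i x_j leave h Y_i Y_j f(n-2), which the
    last term of the bracket cancels. *)
Lemma bracket_act i j f n :
  act (x i * y j - y i * x j - h *: (y i * y j)) f n =
  (X i * Y j - Y i * X j) * f n.
Proof.
rewrite !(actB, actZ, actM, actX, actY) /= !(actX, actY) /=.
by rewrite !(addr1K, subr1K) -!in_algE !rmorphB /=; ring.
Qed.

End GeneratorActions.

Lemma free_act_rel u v : jordan_rel h (@freeX K I) (@freeY K I) u v ->
  free_act u =2 free_act v.
Proof.
apply: jordan_rel_act.
- exact: free_actD.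
- exact: free_actB.
- exact: free_actZ.
- exact: free_actM.
- exact: free_actX.
- exact: free_actY.
Qed.

Lemma free_act_ideal a : gen_ideal (jordan_rel h (@freeX K I) (@freeY K I)) a ->
  forall f n, free_act a f n = 0.
Proof.
elim=> [|{}a b _ IHa _ IHb|{}a b u v uv] f n.
- exact: mmap0.
- by rewrite free_actD IHa IHb addr0.
- rewrite !free_actM (eq_free_act _ (g := fun=> 0)) ?free_act0 // => k.
  by rewrite free_actB (free_act_rel uv) subrr.
Qed.

(** The action lives on the free algebra, so the brackets are lifted there. *)
Definition free_bracket (p : I * I) : freeXY K I :=
  freeX K p.1 * freeY K p.2 - freeY K p.1 * freeX K p.2
  - h *: (freeY K p.1 * freeY K p.2).

Lemma free_act_bracket p f n : free_act (free_bracket p) f n = minor X Y p * f n.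
Proof.
apply: bracket_act.
- exact: free_actB.
- exact: free_actZ.
- exact: free_actM.
- exact: free_actX.
- exact: free_actY.
Qed.

Lemma free_act_bracketX p k f n :
  free_act (free_bracket p ^+ k) f n = minor X Y p ^+ k * f n.
Proof.
elim: k f n => [|k IHk] f n; first by rewrite !expr0 free_act1 mul1r.
by rewrite !exprS free_actM free_act_bracket IHk mulrA.
Qed.

Lemma free_act_monom_eval m f n :
  free_act (monom_eval free_bracket m) f n = monom_eval (minor X Y) m * f n.
Proof.
rewrite /monom_eval; elim: (enum_fset _) f n => [|p s IHs] f n.
  by rewrite !big_nil free_act1 mul1r.
by rewrite !big_cons free_actM free_act_bracketX IHs mulrA.
Qed.

Lemma free_act_poly_eval e f n :
  free_act (poly_eval free_bracket e) f n = poly_eval (minor X Y) e * f n.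
Proof.
rewrite /poly_eval /mmap free_act_sum mulr_suml; apply: eq_bigr => m _.
rewrite free_actM in_algE free_actZ free_act1 free_act_monom_eval.
by rewrite -in_algE mulrA.
Qed.

Lemma bracket_substE e :
  bracket_subst h e = pres_pi (@jordan_proper K d I h) (poly_eval free_bracket e).
Proof.
rewrite /bracket_subst /poly_eval /mmap raddf_sum; apply: eq_bigr => m _ /=.
rewrite rmorphM /= linearZ rmorph1; congr (_ * _).
rewrite /monom_eval rmorph_prod; apply: eq_bigr => p _.
have E (B C : algType K) (f : {lrmorphism B -> C}) a b c d' k :
    f ((a * b - c * d' - h *: (c * b)) ^+ k) =
    (f a * f b - f c * f d' - h *: (f c * f b)) ^+ k.
  have fZ u : f (h *: u) = h *: f u by rewrite linearZ.
  by rewrite rmorphXn !rmorphB /= fZ !rmorphM.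
by symmetry; exact: E.
Qed.

Lemma bracket_subst_eq0_minor e : bracket_subst h e = 0 -> poly_eval (minor X Y) e = 0.
Proof.
rewrite bracket_substE -(rmorph0 (pres_pi (@jordan_proper K d I h))).
(* Acting on the constant function 1 exhibits the multiplier itself. *)
move/pres_pi_eqP; rewrite subr0 => /free_act_ideal/(_ (fun=> 1) 0).
by rewrite free_act_poly_eval mulr1.
Qed.

End JordanAction.

(** * The ideal of syzygies *)

(** Coefficients attached to the same index are added up, which turns a list with repetitions into a
    finitely supported family. *)
Lemma fsfun_of_combination (T : choiceType) (R : comNzRingType) (g : T -> R)
    (u : seq (T * R)) :
  exists P : {fsfun T -> R with 0},
    \sum_(z <- u) g z.1 * z.2 = \sum_(p <- finsupp P) g p * P p.
Proof.
pose E := [fset z | z in unzip1 u]%fset.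
pose P := [fsfun p in E => \sum_(z <- u | z.1 == p) z.2] : {fsfun T -> R with 0}.
exists P.
have PE : (finsupp P `<=` E)%fset by exact: finsupp_sub.
(* Added coefficients may cancel, so the support can be smaller than [E]; the extra terms are
   zero. *)
have -> : \sum_(p <- finsupp P) g p * P p = \sum_(p <- E) g p * P p.
  apply: big_fset_incl => // p _ pP.
  by rewrite (fsfun_dflt pP) mulr0.
rewrite (eq_big_seq (fun p => \sum_(z <- u) (if z.1 == p then g z.1 * z.2 else 0))).
  rewrite exchange_big /= [LHS]big_seq [RHS]big_seq; apply: eq_bigr => z zu.
  have zE : z.1 \in E by rewrite in_fset /=; apply: map_f.
  rewrite (big_fsetD1 z.1) //= eqxx big_seq big1 ?addr0 // => p.
  by rewrite in_fsetD1 eq_sym => /andP[/negbTE ->].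
move=> p pE; rewrite /P fsfun_fun pE mulr_sumr [LHS]big_mkcond.
by apply: eq_bigr => z _; case: eqP => [->|].
Qed.

Section SyzygyIdeal.
Context (K : comNzRingType) (I : Type) (B : comAlgType K) (b : I -> I -> B).
Implicit Types a c : B.

Definition skew_syzygy (p : I * I) : B :=
  let: (i, j) := p in b i j + b j i.

Definition plucker_syzygy (q : I * I * I * I) : B :=
  let: (i, j, k, l) := q in
  b i j * b k l + b i k * b l j + b i l * b j k.

(** Lists may repeat an index, so that sums of combinations are concatenations. *)
Definition in_syzygies a : Prop :=
  exists (u : seq ((I * I) * B)) (v : seq ((I * I * I * I) * B)),
    a = \sum_(z <- u) skew_syzygy z.1 * z.2
      + \sum_(z <- v) plucker_syzygy z.1 * z.2.

Lemma in_syzygies0 : in_syzygies 0.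
Proof. by exists [::], [::]; rewrite !big_nil addr0. Qed.

Lemma in_syzygiesD a c : in_syzygies a -> in_syzygies c -> in_syzygies (a + c).
Proof.
move=> [u [v ->]] [u' [v' ->]]; exists (u ++ u'), (v ++ v').
by rewrite !big_cat /= addrACA.
Qed.

Lemma in_syzygiesMl c a : in_syzygies a -> in_syzygies (c * a).
Proof.
move=> [u [v ->]].
exists [seq (z.1, c * z.2) | z <- u], [seq (z.1, c * z.2) | z <- v].
rewrite !big_map mulrDr !mulr_sumr.
by congr (_ + _); apply: eq_bigr => z _; rewrite mulrCA.
Qed.

Lemma in_syzygiesZ (k : K) a : in_syzygies a -> in_syzygies (k *: a).
Proof. by rewrite -mulr_algl; exact: in_syzygiesMl. Qed.

Lemma in_syzygies_skew i j : in_syzygies (b i j + b j i).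
Proof.
by exists [:: ((i, j), 1)], [::]; rewrite big_seq1 big_nil addr0 mulr1.
Qed.

Lemma in_syzygies_plucker i j k l :
  in_syzygies (b i j * b k l + b i k * b l j
               + b i l * b j k).
Proof.
by exists [::], [:: ((i, j, k, l), 1)]; rewrite big_seq1 big_nil add0r mulr1.
Qed.

Lemma in_syzygies_eval (C : comAlgType K) (f : {rmorphism B -> C}) (X Y : I -> C) :
  (forall i j, f (b i j) = minor X Y (i, j)) ->
  forall a, in_syzygies a -> f a = 0.
Proof.
move=> fb a [u [v ->]]; rewrite rmorphD !rmorph_sum !big1 ?addr0 //.
  move=> [[[[i j] k] l] c] _ /=.
  by rewrite rmorphM !rmorphD !rmorphM !fb /minor /=; ring.
by move=> [[i j] c] _ /=; rewrite rmorphM rmorphD !fb /minor /=; ring.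
Qed.

End SyzygyIdeal.

(** The skew syzygy with j = i is twice the diagonal symbol. *)
Lemma in_syzygies_diag (K : comUnitRingType) (I : Type) (B : comAlgType K)
    (b : I -> I -> B) i :
  (2%:R : K) \is a GRing.unit -> in_syzygies b (b i i).
Proof.
move=> u2; have -> : b i i = 2%:R^-1 *: (b i i + b i i).
  by rewrite -mulr2n -scaler_nat scalerA mulVr // scale1r.
exact/in_syzygiesZ/in_syzygies_skew.
Qed.

(** * Straightening *)

(** With positive gaps x, y, z between the four numbers, (x+y+z)^2 + y^2 exceeds (x+y)^2 + (y+z)^2
    by 2xz, and exceeds x^2 + z^2 by still more. *)
Lemma sqr_unnest (i k l j : nat) : (i < k)%N -> (k < l)%N -> (l < j)%N ->
  ((l - i) ^ 2 + (j - k) ^ 2 < (j - i) ^ 2 + (l - k) ^ 2)%N /\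
  ((k - i) ^ 2 + (j - l) ^ 2 < (j - i) ^ 2 + (l - k) ^ 2)%N.
Proof.
move=> ik kl lj; have [x Ex] : {x | k = (i + x.+1)%N} by exists (k - i).-1; lia.
have [y Ey] : {y | l = (k + y.+1)%N} by exists (l - k).-1; lia.
have [z Ez] : {z | j = (l + z.+1)%N} by exists (j - l).-1; lia.
have -> : (l - i = x.+1 + y.+1)%N by lia.
have -> : (j - k = y.+1 + z.+1)%N by lia.
have -> : (j - i = x.+1 + y.+1 + z.+1)%N by lia.
have -> : (l - k = y.+1)%N by lia.
have -> : (k - i = x.+1)%N by lia.
have -> : (j - l = z.+1)%N by lia.
by rewrite -!mulnn; split; nia.
Qed.

(** * Two-column tableaux and nesting *)

Section StandardTableaux.
Context (d : Order.disp_t) (I : orderType d) (F : seq I).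
Implicit Types (p q : I * I) (s t : seq (I * I)).

(** Only the finitely many indices in [F] matter; their ranks give numerical lengths and weights
    although [I] may be infinite. *)
Definition rank (i : I) : nat := count (fun x => (x < i)%O) F.

Lemma rank_lt i j : i \in F -> (i < j)%O -> (rank i < rank j)%N.
Proof.
rewrite /rank => iF ij; elim: F iF => [//|x s IHs] /=; rewrite inE.
have le : (count (fun x => (x < i)%O) s <= count (fun x => (x < j)%O) s)%N.
  by apply: sub_count => y /= /lt_trans; apply.
case/predU1P => [<-|/IHs lt]; first by rewrite ltxx ij add0n add1n ltnS.
by rewrite -addnS leq_add //; case: (ltP x i) => // /lt_trans/(_ ij) ->.
Qed.

Definition oriented s : bool :=
  all (fun p => [&& p.1 \in F, p.2 \in F & (p.1 < p.2)%O]) s.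

Definition le_pair p q : bool := (p.1 <= q.1)%O && (p.2 <= q.2)%O.

Definition nested p q : bool := (p.1 < q.1)%O && (q.2 < p.2)%O.

(** The pairs are the rows of a semistandard tableau: rows increase strictly, both columns
    weakly. *)
Definition standard s : bool := oriented s && sorted le_pair s.

Definition spread s : nat := \sum_(p <- s) (rank p.2 - rank p.1) ^ 2.

Let lexi_pair p q : bool := (p.1 < q.1)%O || (p.1 == q.1) && (p.2 <= q.2)%O.

(** Once nothing is nested, lexicographic order on the rows forces the second column to increase as
    well. *)
Lemma standard_sort s : oriented s ->
  (forall p q, p \in s -> q \in s -> ~~ nested p q) ->
  exists2 t, standard t & perm_eq s t.
Proof.
move=> os nn; exists (sort lexi_pair s); last by rewrite perm_sym perm_sort.
have lexi_total : total lexi_pair.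
  move=> p q; rewrite /lexi_pair.
  by case: (ltgtP p.1 q.1) => //= _; exact: le_total.
apply/andP; split; first by rewrite /oriented (perm_all _ (permEl (perm_sort _ _))).
apply: (sub_in_sorted (P := mem s)) (sort_sorted lexi_total s).
  move=> p q ps qs; rewrite /lexi_pair /le_pair.
  case/orP => [lt|/andP[/eqP -> ->]]; last by rewrite lexx.
  rewrite (ltW lt) leNgt /=; apply: contra (nn p q ps qs) => gt.
  by rewrite /nested lt.
by apply/allP => p; rewrite mem_sort.
Qed.

(** Each column is sorted, hence determined by its multiset of entries. *)
Lemma standard_inj s t : standard s -> standard t ->
  perm_eq (unzip1 s) (unzip1 t) -> perm_eq (unzip2 s) (unzip2 t) -> s = t.
Proof.
move=> /andP[_ ss] /andP[_ st] e1 e2.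
have h1 u : sorted le_pair u -> sorted <=%O (unzip1 u).
  by apply: homo_sorted => p q /andP[].
have h2 u : sorted le_pair u -> sorted <=%O (unzip2 u).
  by apply: homo_sorted => p q /andP[].
rewrite -[s]zip_unzip -[t]zip_unzip.
by congr zip; apply: le_sorted_eq => //; [exact: h1|exact: h1|exact: h2|exact: h2].
Qed.

End StandardTableaux.

Section Straightening.
Context (K : comUnitRingType) (d : Order.disp_t) (I : orderType d).
Context (B : comAlgType K) (b : I -> I -> B).
Context (two_unit : (2%:R : K) \is a GRing.unit) (F : seq I).

Definition bracket_monom (s : seq (I * I)) : B := \prod_(p <- s) b p.1 p.2.

Definition straightens (a : B) : Prop :=
  exists2 L : seq (K * seq (I * I)), all (fun z => standard F z.2) L &
    in_syzygies b (a - \sum_(z <- L) z.1 *: bracket_monom z.2).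

Lemma straightens_mod a c :
  in_syzygies b (a - c) -> straightens c -> straightens a.
Proof.
move=> ac [L sL cL]; exists L => //.
by rewrite -(subrKA c); exact: in_syzygiesD.
Qed.

Lemma straightens0 : straightens 0.
Proof. by exists [::] => //; rewrite big_nil subr0; exact: in_syzygies0. Qed.

Lemma straightensD a c : straightens a -> straightens c -> straightens (a + c).
Proof.
move=> [L sL aL] [L' sL' cL']; exists (L ++ L'); first by rewrite all_cat sL.
by rewrite big_cat /= opprD addrACA; exact: in_syzygiesD.
Qed.

Lemma straightensZ k a : straightens a -> straightens (k *: a).
Proof.
move=> [L sL aL]; exists [seq (k * z.1, z.2) | z <- L]; first by rewrite all_map.
rewrite big_map (eq_bigr (fun z => k *: (z.1 *: bracket_monom z.2))) => [|z _].
  by rewrite -scaler_sumr -scalerBr; exact: in_syzygiesZ.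
by rewrite scalerA.
Qed.

Lemma straightensB a c : straightens a -> straightens c -> straightens (a - c).
Proof. by rewrite -scaleN1r => Ha Hc; apply/straightensD/straightensZ. Qed.

Lemma bracket_monom_cons p s :
  bracket_monom (p :: s) = b p.1 p.2 * bracket_monom s.
Proof. exact: big_cons. Qed.

Lemma perm_bracket_monom s t : perm_eq s t -> bracket_monom s = bracket_monom t.
Proof. exact: perm_big. Qed.

(** A reversed factor is flipped at the cost of a sign; a diagonal factor puts the whole monomial in
    the ideal, whence [c] = 0. *)
Lemma orient_bracket_monom s : all (fun p => (p.1 \in F) && (p.2 \in F)) s ->
  exists c t, oriented F t /\
    in_syzygies b (bracket_monom s - c *: bracket_monom t).
Proof.
elim: s => [|[i j] s IHs] /=.
  by exists 1, [::]; rewrite scale1r subrr; split=> //; exact: in_syzygies0.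
case/andP=> /andP[iF jF] /IHs[c [t [ot st]]].
have [ij|ji|<-{j jF}] := ltgtP i j.
- exists c, ((i, j) :: t); rewrite /= iF jF ij; split=> //.
  by rewrite !bracket_monom_cons scalerAr -mulrBr; exact: in_syzygiesMl.
- exists (- c), ((j, i) :: t); rewrite /= iF jF ji; split=> //.
  have -> : bracket_monom ((i, j) :: s) - - c *: bracket_monom ((j, i) :: t)
      = bracket_monom s * (b i j + b j i)
        + - b j i * (bracket_monom s - c *: bracket_monom t).
    rewrite !bracket_monom_cons /= -[(- c) *: _]mulr_algl -[c *: _]mulr_algl.
    by rewrite scaleNr; ring.
  by apply: in_syzygiesD; apply: in_syzygiesMl => //; exact: in_syzygies_skew.
- exists 0, [::]; split=> //; rewrite scale0r subr0 bracket_monom_cons mulrC.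
  exact/in_syzygiesMl/in_syzygies_diag.
Qed.

(* For i < k < l < j a nested pair becomes a crossing or a disjoint one; both   *)
(* lower the sum of the squared lengths, which makes the straightening stop.   *)
Lemma unnest_bracket_monom i j k l s :
  in_syzygies b (bracket_monom [:: (i, j), (k, l) & s]
    - (bracket_monom [:: (i, l), (k, j) & s]
       - bracket_monom [:: (i, k), (l, j) & s])).
Proof.
have -> : bracket_monom [:: (i, j), (k, l) & s]
    - (bracket_monom [:: (i, l), (k, j) & s]
       - bracket_monom [:: (i, k), (l, j) & s])
    = bracket_monom s * (b i j * b k l + b i k * b l j + b i l * b j k)
      + - (b i l * bracket_monom s) * (b k j + b j k).
  by rewrite !bracket_monom_cons /=; ring.
by apply: in_syzygiesD; apply: in_syzygiesMl;
  [exact: in_syzygies_plucker|exact: in_syzygies_skew].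
Qed.

(** Induction on [spread]: a nested pair is rewritten into terms of smaller spread, and without
    nested pairs sorting suffices. *)
Lemma oriented_straightens s : oriented F s -> straightens (bracket_monom s).
Proof.
have [n] := ubnP (spread F s); elim: n s => [//|n IHn] s; rewrite ltnS => le os.
have [/hasP[p ps /hasP[q qs pq]]|nn] := boolP (has (fun p => has (nested p) s) s).
  case: p q ps qs pq => [i j] [k l] ps qs /andP[/= ik lj].
  have /and3P[/= iF jF ij] := allP os _ ps.
  have /and3P[/= kF lF kl] := allP os _ qs.
  pose r := rem (k, l) (rem (i, j) s).
  have ser : perm_eq s [:: (i, j), (k, l) & r].
    rewrite (perm_trans (perm_to_rem ps)) // perm_cons perm_to_rem //.
    have := qs; rewrite (perm_mem (perm_to_rem ps)) inE xpair_eqE.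
    (* Since i < k the two pairs differ, so the second survives removal of the first. *)
    by rewrite (gt_eqF ik).
  have ro : oriented F r.
    by have := os; rewrite /oriented (perm_all _ ser) => /= /and3P[].
  have spreadE : spread F s =
      ((rank F j - rank F i) ^ 2 + ((rank F l - rank F k) ^ 2 + spread F r))%N.
    by rewrite /spread (perm_big _ ser) !big_cons.
  have [lt1 lt2] := sqr_unnest (rank_lt iF ik) (rank_lt kF kl) (rank_lt lF lj).
  rewrite (perm_bracket_monom ser).
  apply: straightens_mod (unnest_bracket_monom i j k l r) _.
  apply: straightensB; apply: IHn.
  - apply: leq_trans le; rewrite spreadE /spread !big_cons -/(spread F r) /=.
    by rewrite !addnA ltn_add2r.
  - by rewrite /= ro iF jF kF lF (lt_trans kl lj) (lt_trans ik kl).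
  - apply: leq_trans le; rewrite spreadE /spread !big_cons -/(spread F r) /=.
    by rewrite !addnA ltn_add2r.
  - by rewrite /= ro iF jF kF lF ik lj.
have [p q ps qs|t st pst] := standard_sort os.
  by apply: contra nn => pq; apply/hasP; exists p => //; apply/hasP; exists q.
exists [:: (1, t)]; first by rewrite /= st.
by rewrite big_seq1 scale1r (perm_bracket_monom pst) subrr; exact: in_syzygies0.
Qed.

Lemma bracket_monom_straightens s :
  all (fun p => (p.1 \in F) && (p.2 \in F)) s -> straightens (bracket_monom s).
Proof.
move=> /orient_bracket_monom[c [t [ot st]]].
by apply: straightens_mod st _; apply/straightensZ/oriented_straightens.
Qed.



End Straightening.

(** * Linear independence of standard monomials *)

Lemma malgUM (R : nzRingType) (G : monomType) (m m' : G) :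
  << m >> * << m' >> = << mmul m m' >> :> {malg R[G]}.
Proof. by rewrite (malgMEw msuppU_le msuppU_le) !big_seq_fset1 !mcoeffUU mulr1. Qed.

(** Compares a product with the product of leading terms [u], [v]; the factor [c] is kept as
    [v + (c - v)] because weight bounds are known for these two parts. *)
Lemma mulrB_split (R : pzRingType) (a c u v : R) :
  a * c - u * v = u * (c - v) + (a - u) * (v + (c - v)).
Proof. by rewrite [v + _]addrC subrK mulrBr mulrBl [RHS]addrC subrKA. Qed.

Section Independence.
Context (K : comUnitRingType) (d : Order.disp_t) (I : orderType d) (F : seq I).

Local Notation mono := {cmonom (I + I)%type}.
Local Notation M := {malg K[mono]}.

Definition varX (i : I) : M := << ucm (inl i) >>.
Definition varY (i : I) : M := << ucm (inr i) >>.
Definition minorXY (i j : I) : M := minor varX varY (i, j).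

(** X_i weighs its rank and Y_i nothing. [undup] is there because [F] may have repetitions. *)
Definition weight (m : mono) : nat := \sum_(i <- undup F) m (inl i) * rank F i.

Definition lead_pair (i j : I) : mono := mmul (ucm (inl i)) (ucm (inr j)).

Definition lead (s : seq (I * I)) : mono :=
  foldr (fun p m => mmul (lead_pair p.1 p.2) m) mone s.

Lemma weightM m m' : weight (mmul m m') = (weight m + weight m')%N.
Proof. by rewrite -big_split; apply: eq_bigr => i _; rewrite cmM mulnDl. Qed.

Lemma weight_lead_pair i j : i \in F -> weight (lead_pair i j) = rank F i.
Proof.
move=> iF; rewrite weightM.
have -> : weight (ucm (inr j)) = 0%N by rewrite /weight big1 // => k _; rewrite cmU.
rewrite addn0 /weight (bigD1_seq i) ?undup_uniq ?mem_undup //= cmUU mul1n.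
rewrite big1 ?addn0 // => k ki; rewrite cmU.
suff -> : (@inl I I i == inl k) = false by [].
by apply: contra_neqF ki => /eqP[].
Qed.

Lemma lead_inl s i : lead s (inl i) = count_mem i (unzip1 s).
Proof. by elim: s => [|p s IHs] /=; rewrite ?cm1 // !cmM !cmU IHs addn0. Qed.

Lemma lead_inr s i : lead s (inr i) = count_mem i (unzip2 s).
Proof. by elim: s => [|p s IHs] /=; rewrite ?cm1 // !cmM !cmU IHs add0n. Qed.

(** The exponents of the X and Y variables in the leading term record the two columns. *)
Lemma lead_inj s t : standard F s -> standard F t -> lead s = lead t -> s = t.
Proof.
move=> ss st e; apply: (standard_inj ss st); apply/allP => i _ /=.
  by rewrite -!lead_inl e.
by rewrite -!lead_inr e.
Qed.

Definition weight_ge (n : nat) (f : M) : Prop :=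
  forall m, f@_m != 0 -> (n <= weight m)%N.

Lemma weight_geU n m : (n <= weight m)%N -> weight_ge n << m >>.
Proof.
by move=> nm k; rewrite mcoeffU1; case: (eqVneq m k) => [<-|_] //; rewrite eqxx.
Qed.

Lemma weight_geN n f : weight_ge n f -> weight_ge n (- f).
Proof. by move=> nf m; rewrite mcoeffN oppr_eq0; exact: nf. Qed.

Lemma weight_geD n f g : weight_ge n f -> weight_ge n g -> weight_ge n (f + g).
Proof.
move=> nf ng m; rewrite mcoeffD => fg.
have [f0|/nf //] := eqVneq f@_m 0; apply: ng.
by apply: contra_neq fg => ->; rewrite f0 addr0.
Qed.

Lemma weight_geM n k f g :
  weight_ge n f -> weight_ge k g -> weight_ge (n + k) (f * g).
Proof.
move=> nf kg m; rewrite mcoeff_neq0 => /msuppM_le[m1 [m2 [m1f m2g ->]]].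
by rewrite weightM leq_add ?nf ?kg // mcoeff_neq0.
Qed.

Lemma weight_geS n f : weight_ge n.+1 f -> weight_ge n f.
Proof. by move=> nf m /nf /ltnW. Qed.

(* Since i < j, the term X_i Y_j of X_i Y_j - Y_i X_j is the one of least      *)
(* weight.                                                                     *)
Lemma minorXY_lead i j : i \in F -> (i < j)%O -> j \in F ->
  weight_ge (rank F i).+1 (minorXY i j - << lead_pair i j >>).
Proof.
move=> iF ij jF; have -> : minorXY i j - << lead_pair i j >> = - << lead_pair j i >>.
  rewrite /minorXY /minor [X in X - _ - _]malgUM [X in _ - X - _]malgUM /=.
  by rewrite addrAC subrr add0r; congr (- << _ >>); rewrite [LHS]mulmC.
by apply/weight_geN/weight_geU; rewrite weight_lead_pair ?rank_lt.
Qed.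

(** Leading terms multiply, and every other product involves an error term of strictly larger
    weight. *)
Lemma bracket_monom_lead s : oriented F s ->
  weight_ge (weight (lead s)).+1 (bracket_monom minorXY s - << lead s >>).
Proof.
elim: s => [_|[i j] s IHs /= /andP[/and3P[iF jF ij] /IHs hs]].
  by rewrite /bracket_monom big_nil subrr => m; rewrite mcoeff0 eqxx.
have hp := minorXY_lead iF ij jF.
rewrite bracket_monom_cons weightM /= -[X in _ - X]malgUM mulrB_split.
apply: weight_geD.
  by rewrite -addnS; apply: weight_geM; [exact: weight_geU|exact: hs].
rewrite -addSn weight_lead_pair //; apply: weight_geM; first exact: hp.
by apply: weight_geD; [exact: weight_geU|exact: weight_geS hs].
Qed.

Lemma bracket_monom_coeff s m : oriented F s -> (weight m <= weight (lead s))%N ->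
  (bracket_monom minorXY s)@_m = (lead s == m)%:R.
Proof.
move=> os le; rewrite -[bracket_monom _ s](subrK << lead s >>) mcoeffD mcoeffU1.
have [->|/(bracket_monom_lead os)] :=
    eqVneq (bracket_monom minorXY s - << lead s >>)@_m 0.
  by rewrite add0r.
by rewrite ltnNge le.
Qed.

Lemma standard_minors_free (V : lmodType K) (b : seq (I * I) -> V)
    (L : seq (K * seq (I * I))) :
  all (fun z => standard F z.2) L ->
  \sum_(z <- L) z.1 *: bracket_monom minorXY z.2 = 0 ->
  \sum_(z <- L) z.1 *: b z.2 = 0.
Proof.
have [n] := ubnP (size L); elim: n L => [//|n IHn] L; rewrite ltnS => sz sL L0.
have [->|Lnil] := eqVneq L [::]; first by rewrite big_nil.
have [z0 z0L z0min] : exists2 z0, z0 \in L &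
    forall z, z \in L -> (weight (lead z0.2) <= weight (lead z.2))%N.
  pose le : rel (K * seq (I * I)) := relpre (fun z => weight (lead z.2)) leq.
  have : sorted le (sort le L) by apply: sort_sorted => y z; exact: leq_total.
  have := mem_sort le L; case: (sort le L) => [|z0 L'] memL.
    by case: L Lnil memL {sz sL L0} => // z L _ /(_ z); rewrite mem_head.
  rewrite /= path_sortedE; last by move=> ? ? ?; exact: leq_trans.
  case/andP=> /allP z0L' _; exists z0; first by rewrite -memL mem_head.
  by move=> z; rewrite -memL inE => /predU1P[->|/z0L'].
(* Compare coefficients at the leading monomial of [z0]: by minimality only the entries with the
   same tableau contribute. *)
have c0 : \sum_(z <- L | z.2 == z0.2) z.1 = 0.
  apply: (etrans _ (mcoeff0 (lead z0.2))); rewrite -L0.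
  rewrite raddf_sum big_mkcond [LHS]big_seq [RHS]big_seq; apply: eq_bigr => z zL /=.
  have sz2 := allP sL _ zL; have sz0 := allP sL _ z0L.
  rewrite mcoeffZ bracket_monom_coeff ?z0min //; last by case/andP: sz2.
  have -> : (lead z.2 == lead z0.2) = (z.2 == z0.2).
    by apply/eqP/eqP => [|-> //]; exact: lead_inj.
  by case: (_ == _); rewrite ?mulr1 ?mulr0.
have drop (W : lmodType K) (f : seq (I * I) -> W) :
    \sum_(z <- L) z.1 *: f z.2 = \sum_(z <- [seq z <- L | z.2 != z0.2]) z.1 *: f z.2.
  rewrite big_filter [LHS](bigID (fun z => z.2 == z0.2)) /=.
  rewrite (eq_bigr (fun z => z.1 *: f z0.2)); last by move=> z /eqP ->.
  by rewrite -scaler_suml c0 scale0r add0r.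
rewrite drop; apply: IHn; last by rewrite -drop.
  apply: leq_trans sz; rewrite size_filter -(count_predC (fun z => z.2 == z0.2) L).
  rewrite -[X in (X < _)%N]add0n ltn_add2r -has_count; apply/hasP.
  by exists z0 => /=.
by rewrite all_filter; apply/allP => z zL; apply/implyP => _; exact: (allP sL).
Qed.

End Independence.

(** * The kernel of the substitution *)

Lemma malgU_scale (R : nzRingType) (G : monomType) (c : R) (m : G) :
  << c *g m >> = c *: << m >>.
Proof. by apply/malgP => k; rewrite mcoeffZ !mcoeffU mulrnAr mulr1. Qed.

Section MinorEvaluation.
Context (K : comUnitRingType) (d : Order.disp_t) (I : orderType d).
Local Notation M := {malg K[{cmonom (I + I)%type}]}.

Definition minor_eval (e : bracket_poly K I) : M :=
  poly_eval (minor (@varX K d I) (@varY K d I)) e.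

Let minorC p q : GRing.comm (minor (@varX K d I) (@varY K d I) p)
                            (minor (@varX K d I) (@varY K d I) q).
Proof. exact: mulrC. Qed.

HB.instance Definition _ := GRing.isZmodMorphism.Build
  (bracket_poly K I) M minor_eval (poly_eval_is_zmod_morphism _).
HB.instance Definition _ := GRing.isMonoidMorphism.Build
  (bracket_poly K I) M minor_eval (poly_eval_is_monoid_morphism minorC).
HB.instance Definition _ := GRing.isScalable.Build
  K (bracket_poly K I) M *:%R minor_eval (poly_eval_is_scalable minorC).

Lemma minor_eval_bsym i j : minor_eval (bsym K i j) = minorXY K i j.
Proof. exact: poly_eval_var. Qed.

Lemma minor_eval_bracket_monom s :
  minor_eval (bracket_monom (@bsym K d I) s) = bracket_monom (@minorXY K d I) s.
Proof.
rewrite /bracket_monom rmorph_prod; apply: eq_bigr => p _.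
exact: minor_eval_bsym.
Qed.

(** Variables are split off one at a time, by induction on the degree. *)
Lemma malgU_bracket_monom (m : {cmonom (I * I)%type}) :
  exists2 s, {subset s <= finsupp m} &
    << m >> = bracket_monom (@bsym K d I) s.
Proof.
have [n] := ubnP (mdeg m); elim: n m => [//|n IHn] m; rewrite ltnS => le.
have [-> |m1] := eqVneq m mone.
  by exists [::] => //; rewrite /bracket_monom big_nil.
have [p pm] : exists p, p \in finsupp m.
  apply/fset0Pn; apply: contra m1 => /eqP m0; apply/eqP/mdeg_eq0I.
  by rewrite mdegE m0 big_seq_fset0.
have mE : m = mmul (ucm p) (divcm m (ucm p)).
  apply/eqP/cmP => q; rewrite cmM divcmE ucmE; case: eqVneq => [<-|_] /=.
    by rewrite subnKC // lt0n cmE_neq0.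
  by rewrite subn0.
have [|s sm sE] := IHn (divcm m (ucm p)).
  by apply: leq_trans le; rewrite [in X in (_ < X)%N]mE mdegM mdegU.
exists (p :: s).
  by move=> q; rewrite inE => /predU1P[-> //|/sm qs]; rewrite mE mdomD in_fsetU qs orbT.
rewrite bracket_monom_cons -sE {1}mE /bsym -surjective_pairing; symmetry.
exact: malgUM.
Qed.

Context (two_unit : (2%:R : K) \is a GRing.unit).

Lemma bracket_poly_straightens (e : bracket_poly K I) :
  exists F : seq I, straightens (@bsym K d I) F e.
Proof.
(* [G] collects all pairs occurring in [e]; their entries form the finite index list. *)
pose G := flatten [seq enum_fset (finsupp (m : {cmonom (I * I)%type}))
                  | m <- enum_fset (msupp e)].
exists (unzip1 G ++ unzip2 G).
rewrite [e]monalgE big_seq; apply: big_ind.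
- exact: straightens0.
- exact: straightensD.
move=> m me; rewrite malgU_scale; apply: straightensZ.
have [s sm ->] := malgU_bracket_monom m.
apply: bracket_monom_straightens => //; apply/allP => p /sm pm.
have pG : p \in G by apply/flattenP; exists (enum_fset (finsupp m)) => //; exact: map_f.
by rewrite !mem_cat !map_f ?orbT.
Qed.

Lemma minor_eval_eq0 (e : bracket_poly K I) :
  minor_eval e = 0 -> in_syzygies (@bsym K d I) e.
Proof.
move=> e0; have [F [L sL eL]] := bracket_poly_straightens e.
have := in_syzygies_eval (f := minor_eval) minor_eval_bsym eL.
rewrite rmorphB /= e0 sub0r => /eqP; rewrite oppr_eq0 => /eqP L0.
suff E : \sum_(z <- L) z.1 *: bracket_monom (@bsym K d I) z.2 = 0.
  by move: eL; rewrite E subr0.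
(* Independence is applied with [b] the monomials in the symbols, lifting the relation from minors
   to symbols. *)
apply: (standard_minors_free _ sL); rewrite -[RHS]L0 rmorph_sum.
by apply: eq_bigr => z _; rewrite /= linearZ -minor_eval_bracket_monom.
Qed.

End MinorEvaluation.

Theorem theorem5 (R : realType) (d : Order.disp_t) (I : orderType d)
    (h : R[i]) (h_neq0 : h != 0) (e : bracket_poly R[i] I) :
  bracket_subst h e = 0 ->
  exists (P : {fsfun I * I -> bracket_poly R[i] I with 0})
         (Q : {fsfun I * I * I * I -> bracket_poly R[i] I with 0}),
    e = \sum_(p <- finsupp P)
           (let: (i, j) := p in bsym R[i] i j + bsym R[i] j i) * P p
      + \sum_(q <- finsupp Q)
           (let: (i, j, k, l) := q in
            bsym R[i] i j * bsym R[i] k l + bsym R[i] i k * bsym R[i] l j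
            + bsym R[i] i l * bsym R[i] j k) * Q q.
Proof.
move=> /(bracket_subst_eq0_minor (@varX R[i] d I) (@varY R[i] d I)) e0.
(* Characteristic zero makes 2 invertible, as the diagonal symbols require. *)
have two_unit : (2%:R : R[i]) \is a GRing.unit by rewrite unitfE pnatr_eq0.
have [u [v ->]] := minor_eval_eq0 two_unit e0.
have [P ->] := fsfun_of_combination (skew_syzygy (@bsym R[i] d I)) u.
have [Q ->] := fsfun_of_combination (plucker_syzygy (@bsym R[i] d I)) v.
by exists P, Q.
Qed.
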